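(* Let $X$ be a positive-dimensional pseudo-symmetric smooth toric Fano variety together with a decomposition $$X\simeq(\mathbb P^1)^s\times(V^2)^a\times(\widetilde V^2)^b\times\prod_{\alpha=1}^pV^{2m_\alpha}\times\prod_{\beta=1}^q\widetilde V^{2n_\beta},$$ where $s,a,b,p,q$ are nonnegative integers and $m_\alpha\ge2$ $(1\le\alpha\le p)$, $n_\beta\ge2$ $(1\le\beta\le q)$ are integers. Then $$\tau_X(\mathbb Z)=2s+3(a+b)+2(p+q),$$ $$\tau_X(\mathbb Q)=2s+3(a+b)+2(p+q)+\sum_{\alpha=1}^p\frac1{m_\alpha}+\sum_{\beta=1}^q\frac1{n_\beta},$$ and therefore $$\delta(X)=\sum_{\alpha=1}^p\frac1{m_\alpha}+\sum_{\beta=1}^q\frac1{n_\beta}.$$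
   Context: All toric varieties are over an algebraically closed field. Gongyo indices. For a smooth projective toric variety $X$, a nonzero class $D\in\mathrm{Nef}(X)\cap\mathrm{Pic}(X)$ and $\mathbb K\in\{\mathbb Z,\mathbb Q\}$, put $$\tau_X(D;\mathbb K)=\sup\Big\{\sum_{i=1}^r a_i\ \Big|\ D=\sum_{i=1}^r a_iD_i,\ 0\ne D_i\in\mathrm{Nef}(X)\cap\mathrm{Pic}(X),\ a_i\in\mathbb K_{>0}\Big\}$$ (for $\mathbb K=\mathbb Q$ the equality is in $\mathrm{Pic}(X)\otimes\mathbb Q$), and $\delta_X(D)=\tau_X(D;\mathbb Q)-\tau_X(D;\mathbb Z)$. If $-K_X$ is nef and nonzero, $\tau_X(\mathbb K):=\tau_X(-K_X;\mathbb K)$ and $\delta(X):=\delta_X(-K_X)$. A smooth toric Fano variety $X=X_\Sigma$ of dimension $d$ is pseudo-symmetric if there is a maximal cone $\sigma\in\Sigma(d)$ with $-\sigma\in\Sigma(d)$. (By a theorem of Ewald every pseudo-symmetric smooth toric Fano variety has a decomposition as in the claim.) A primitive collection of a smooth complete fan is a set of primitive ray generators that does not span a cone although every proper subset does; a set of ray generators spans a cone iff it contains no primitive collection. The varieties $V^{2m}$ and $\widetilde V^{2m}$ ($m\ge1$). Let $N\simeq\mathbb Z^{2m}$ and let $x_1,\dots,x_{2m+1}\in N$ with $x_1,\dots,x_{2m}$ a basis and $x_1+\cdots+x_{2m+1}=0$; put $y_i=-x_i$. For $n\in\{2m,2m+1\}$ let $Z^0_{m,n}$ be the smooth toric Fano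 variety of dimension $2m$ whose fan has primitive ray generators $x_1,\dots,x_{2m+1},y_1,\dots,y_n$ and whose primitive collections are exactly $\{x_i,y_i\}$ ($1\le i\le n$), $\{x_j\mid j\in\{1,\dots,2m+1\}\setminus I\}$ for $I\subset\{1,\dots,n\}$ with $|I|=m$, and $\{y_j\mid j\in J\}$ for $J\subset\{1,\dots,n\}$ with $|J|=m+1$. Then $V^{2m}:=Z^0_{m,2m+1}$ and $\widetilde V^{2m}:=Z^0_{m,2m}$. In particular $V^2$ and $\widetilde V^2$ are the toric del Pezzo surfaces of degree $6$ and $7$, i.e. the blow-ups of $\mathbb P^2$ at three, resp. two, torus-fixed points. *)

(* Defs.v *)
From HB Require Import structures.
From mathcomp Require Import all_boot all_order all_algebra.
From mathcomp Require Import all_classical all_reals all_analysis.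

Set Implicit Arguments.
Unset Strict Implicit.
Unset Printing Implicit Defensive.

Import Order.TTheory GRing.Theory Num.Theory.
Local Open Scope ring_scope.

(** A smooth toric variety is represented by its fan (none of the notions below
    depends on the ground field).  The cones of a smooth fan are simplicial, so
    a cone is recorded as the set of its primitive ray generators; the lattice
    is [N = Z^fdim].  [fan] is raw data; the axioms are in [smooth_complete]. *)
Record fan := Fan {
  fdim : nat;
  fray : finType;
  fgen : fray -> 'rV[int]_fdim;
  fcones : {set {set fray}}
}.

(** The real polyhedral cone in [N_R] spanned by the rays in [A]. *)
Definition cone_of (R : realType) (X : fan) (A : {set fray X}) :
    set 'rV[R]_(fdim X) :=
  (fun v => exists c : fray X -> R,
     (forall i, i \in A -> 0 <= c i) /\
     v = \sum_(i in A) c i *: map_mx intr (fgen i))%classic.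
Arguments cone_of R {X} A _.

(** [Sigma(k)]; by smoothness the dimension of a cone is its number of rays. *)
Definition fcones_dim (X : fan) (k : nat) : {set {set fray X}} :=
  [set A in fcones X | #|A| == k]%SET.

Definition part_of_basis (X : fan) (A : {set fray X}) : Prop :=
  exists (B : 'M[int]_(fdim X)) (f : fray X -> 'I_(fdim X)),
    [/\ B \in unitmx, {in A &, injective f} &
        forall i, i \in A -> fgen i = row (f i) B].

Definition smooth_complete (R : realType) (X : fan) : Prop :=
  [/\ finset.set0 \in fcones X /\ (forall i : fray X, [set i]%SET \in fcones X),
      (forall A B : {set fray X},
         A \in fcones X -> B \subset A -> B \in fcones X),
      (forall A B : {set fray X}, A \in fcones X -> B \in fcones X ->
         (cone_of R A `&` cone_of R B)%classic = cone_of R (A :&: B)%SET),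
      (forall A : {set fray X}, A \in fcones X -> part_of_basis A)
    & (forall v : 'rV[R]_(fdim X),
         exists2 A : {set fray X}, A \in fcones X & cone_of R A v)].

Definition pseudo_symmetric (R : realType) (X : fan) : Prop :=
  exists A B : {set fray X},
    [/\ A \in fcones_dim X (fdim X), B \in fcones_dim X (fdim X) &
        cone_of R B = [set - v | v in cone_of R A]%classic].

(** Isomorphism of toric varieties, i.e. of fans: a lattice isomorphism
    [P : N -> N'] (acting on row vectors) carrying the rays and the cones of
    one fan bijectively to those of the other. *)
Definition fan_iso (X Y : fan) : Prop :=
  exists (P : 'M[int]_(fdim X, fdim Y)) (Q : 'M[int]_(fdim Y, fdim X))
         (f : fray X -> fray Y),
    [/\ P *m Q = 1%:M /\ Q *m P = 1%:M,
        bijective f,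
        (forall i, fgen (f i) = fgen i *m P)
      & (forall A : {set fray X}, ((f @: A)%SET \in fcones Y) = (A \in fcones X))].

(** A torus-invariant divisor [sum_i (D i) D_i], where [D_i] is the prime
    divisor of the ray [i], with coefficients in [K]. *)
Definition tdiv (K : Type) (X : fan) := fray X -> K.

(** Linear equivalence: the difference is the divisor of a character
    [u] in [M] (resp. in [M_Q] if [K = rat]).  Thus [Pic X] is
    [tdiv int X] modulo [lin_equiv], and [Pic X (x) Q] is [tdiv rat X] modulo
    [lin_equiv]. *)
Definition lin_equiv (K : numDomainType) (X : fan) (D E : tdiv K X) : Prop :=
  exists u : 'cV[K]_(fdim X),
    forall i, D i - E i = (map_mx intr (fgen i) *m u) 0 0.

(** [inv_curve C]: [C i] is the intersection number of [D_i] with the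
    torus-invariant curve of some wall [t] in [Sigma(dim X - 1)].  If [v] and
    [v'] are the rays completing [t] to the two adjacent maximal cones, these
    numbers are 1 for [v] and [v'], 0 for the rays outside [t], [v], [v'], and
    on [t] they are the coefficients of the wall relation. *)
Definition inv_curve (X : fan) (C : fray X -> int) : Prop :=
  exists (t : {set fray X}) (v v' : fray X),
    [/\ t \in fcones X /\ (#|t|.+1 = fdim X)%N,
        [/\ v \notin t, v' \notin t & v != v'],
        (v |: t)%SET \in fcones X /\ (v' |: t)%SET \in fcones X,
        [/\ C v = 1, C v' = 1 &
            forall i, i \notin (v |: (v' |: t))%SET -> C i = 0]
      & \sum_i C i *: fgen i = 0].

Definition intersection (X : fan) (D : tdiv int X) (C : fray X -> int) : int :=
  \sum_i D i * C i.

(** The cone of curves of a complete toric variety is generated by the finitely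
    many torus-invariant curves, so these suffice to test nefness, and (Kleiman)
    ampleness. *)
Definition nef (X : fan) (D : tdiv int X) : Prop :=
  forall C, inv_curve C -> 0 <= intersection D C.

Definition ample (X : fan) (D : tdiv int X) : Prop :=
  forall C, inv_curve C -> 0 < intersection D C.

(** [- K_X], the sum of all the [D_i]. *)
Definition anticanonical (X : fan) : tdiv int X := fun=> 1.
Arguments anticanonical : clear implicits.

Definition fano (X : fan) : Prop := ample (anticanonical X).

(** [tau_X(D; K)], with [K] embedded in the reals by [iota]. *)
Definition gongyo (R : realType) (K : numDomainType) (iota : K -> R)
    (X : fan) (D : tdiv int X) : \bar R :=
  ereal_sup (fun t : \bar R =>
    exists (r : nat) (a : 'I_r -> K) (E : 'I_r -> tdiv int X),
      [/\ (forall k, 0 < a k),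
          (forall k, nef (E k) /\ ~ lin_equiv (E k) (fun=> 0)),
          lin_equiv (fun i => (D i)%:~R : K)
                    (fun i => \sum_(k < r) a k * (E k i)%:~R)
        & t = (\sum_(k < r) iota (a k))%:E])%classic.

Definition tauZ (R : realType) (X : fan) : \bar R :=
  gongyo (intr : int -> R) (anticanonical X).

Definition tauQ (R : realType) (X : fan) : \bar R :=
  gongyo (ratr : rat -> R) (anticanonical X).

Definition delta (R : realType) (X : fan) : \bar R := (tauQ R X - tauZ R X)%E.

Definition fan_pt : fan :=
  @Fan 0 void (fun=> 0) [set finset.set0]%SET.

Definition fan_prod (X Y : fan) : fan :=
  @Fan (fdim X + fdim Y) (fray X + fray Y)%type
    (fun i => match i with
              | inl j => row_mx (fgen j) 0
              | inr j => row_mx 0 (fgen j)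
              end)
    [set A : {set fray X + fray Y} |
      (inl @^-1: A \in fcones X) && (inr @^-1: A \in fcones Y)]%SET.

Notation "\xfan_ ( i < n ) F" := (\big[fan_prod/fan_pt]_(i < n) F)
  (at level 36, F at level 36, i at level 0, n at level 50,
   format "\xfan_ ( i  <  n )  F").
Notation "X \xF Y" := (fan_prod X Y) (at level 40, left associativity).

Definition fan_exp (X : fan) (s : nat) : fan := \xfan_(i < s) X.

Definition P1 : fan :=
  @Fan 1 bool (fun e => if e then 1%:M else - 1%:M)
    [set A : {set bool} | (#|A| <= 1)%N]%SET.

(** [x_1, ..., x_{2m}] (indices [0, ..., 2m - 1] here) is the standard basis,
    and [x_{2m+1} = - (x_1 + ... + x_{2m})]. *)
Definition xgen (m : nat) (i : 'I_(2 * m).+1) : 'rV[int]_(2 * m) :=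
  if unlift ord_max i is Some j then delta_mx 0 j else const_mx (- 1).

Section Z0.
Variables (m n : nat).

(** [inl i] is the ray of [x_i], [inr i] that of [y_i]. *)
Definition Z0ray : finType := ('I_(2 * m).+1 + 'I_n)%type.

(** The index of [x_i] for [i] among the indices of the [y_i]; this is meaningful
    for [n <= 2m + 1]. *)
Definition Z0idx (i : 'I_n) : 'I_(2 * m).+1 := inord i.

Definition Z0gen (i : Z0ray) : 'rV[int]_(2 * m) :=
  match i with inl j => xgen j | inr j => - xgen (Z0idx j) end.

Definition Z0primitive : {set {set Z0ray}} :=
  [set P : {set Z0ray} |
    [|| [exists i : 'I_n, P == [set inl (Z0idx i); inr i]],
        [exists I : {set 'I_n}, (#|I| == m) && (P == inl @: ~: (Z0idx @: I))]
      | [exists J : {set 'I_n}, (#|J| == m.+1) && (P == inr @: J)]]]%SET.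

Definition Z0 : fan :=
  @Fan (2 * m) Z0ray Z0gen
    [set A : {set Z0ray} | [forall P in Z0primitive, ~~ (P \subset A)]]%SET.

End Z0.

(** [V m] and [Vt m] have dimension [2m]. *)
Definition V (m : nat) : fan := Z0 m (2 * m).+1.
Definition Vt (m : nat) : fan := Z0 m (2 * m).

(* Main.v *)
Require Import Defs.
From mathcomp Require Import all_boot all_order all_algebra.
From mathcomp Require Import all_classical all_reals all_analysis.
From mathcomp Require Import zify ring.

(**
The invariant [tau] is additive on products and is computed on each factor.

Products.  A divisor class on [X x Y] is a pair of classes, and it is nef iff
both components are; so a decomposition of [- K] on [X x Y] restricts to
decompositions of [- K_X] and [- K_Y].  Every nonzero summand stays nonzero on
one factor at least, which bounds the sum of its coefficients by the sum of
the two bounds ([tau_le_prod]).  Conversely, decompositions pulled back from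
the factors can be added ([tau_ge_prod]).

The factors [Z0 m n], [2m <= n <= 2m + 1].  The polytope of a divisor [E] is,
up to translation, a slice of a box: in the coordinates [t_j = <x_j, u>] shifted
by [E (x_j)], it is
   { t | 0 <= t_j, t_(idx i) <= width E i for i < n, sum_j t_j = degree E },
where [width E i] adds the coefficients of [x_i] and [y_i], and [degree E] those
of all the [x_j].  These numbers determine the class of [E]
([Z0_lin_equiv]).  The relations [sum_(j not in T) x_j = sum_(i in T) y_i] with
[|T| = m] or [|T| = m + 1] come from torus-invariant curves, and they show that
for [E] nef every sum of [m] widths is at most the degree and every sum of
[m + 1] widths at least the degree.  If [E] is integral and nonzero, at least
[m] of the widths are positive: otherwise [m + 1] of them vanish, so that the
degree, hence everything, vanishes.  Therefore [degree E >= m]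
([nef_degree_ge]).  As [- K] has degree [2m + 1], rational coefficients add up
to at most [(2m + 1) / m = 2 + 1/m], and integral ones to at most the integral
part of this number, which is [2] for [m >= 2] and [3] for [m = 1].

Both bounds are attained by slices of the unit cube.  With rational coefficients,
[- K] is [1/m] times the sum of the [2m + 1] divisors of degree [m] whose
widths are all [1] except a single [0]; this is integral if [m = 1].  With
integral coefficients, it is the sum of the slices of degrees [m] and [m + 1]
of the full cube, all widths being [1].  That such slices are nef is checked by
exhibiting, for every cone, an effective divisor in the class which avoids the
corresponding orbit ([Z0_globally_generated]).
*)

Set Implicit Arguments.
Unset Strict Implicit.
Unset Printing Implicit Defensive.

Import Order.TTheory GRing.Theory Num.Theory.
Local Open Scope ring_scope.

(** * Finite sets and sums *)

Lemma subset_between (T : finType) (A B : {set T}) (k : nat) :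
  A \subset B -> (#|A| <= k <= #|B|)%N ->
  exists S : {set T}, [/\ A \subset S, S \subset B & #|S| = k].
Proof.
move=> AB; elim: k => [|k IHk] /andP[Ak kB].
  by exists A; split=> //; apply/eqP; rewrite -leqn0.
have [A_le|A_gt] := leqP #|A| k; last first.
  by exists A; split=> //; apply/eqP; rewrite eqn_leq Ak A_gt.
have [|S [AS SB Sk]] := IHk; first by rewrite A_le ltnW.
have /properP[_ [x xB xS]] : S \proper B by rewrite properEcard SB Sk.
exists (x |: S)%SET; split; last by rewrite cardsU1 xS Sk.
  exact: fintype.subset_trans AS (finset.subsetUr _ _).
by rewrite finset.subUset finset.sub1set xB.
Qed.

Lemma setD2K (T : finType) (x y : T) (A : {set T}) :
  x \in A -> x != y -> (x |: (A :\ x :\ y))%SET = (A :\ y)%SET.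
Proof.
move=> xA xy; apply/setP => z; rewrite !inE.
by case: eqVneq => [->|//]; rewrite xA xy.
Qed.

Lemma setD2Kr (T : finType) (x y : T) (A : {set T}) :
  y \in A -> x != y -> (y |: (A :\ x :\ y))%SET = (A :\ x)%SET.
Proof. by move=> yA xy; rewrite finset.setD1K // !inE eq_sym xy. Qed.

Lemma card_setD2 (T : finType) (x y : T) (A : {set T}) :
  x \in A -> y \in A -> x != y -> #|(A :\ x :\ y)%SET|.+2 = #|A|.
Proof.
by move=> xA yA xy; rewrite (cardsD1 x A) (cardsD1 y (A :\ x)) xA !inE eq_sym xy yA.
Qed.

Lemma sum_indicator (V : pzSemiRingType) (T : finType) (A : {set T}) :
  \sum_j (j \in A)%:R = #|A|%:R :> V.
Proof.
rewrite -sum1_card natr_sum [RHS]big_mkcond; apply: eq_bigr => j _.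
by case: (j \in A).
Qed.

Lemma sum_lift_max (V : nmodType) (k : nat) (g : 'I_k.+1 -> V) :
  \sum_j g j = \sum_(j < k) g (lift ord_max j) + g ord_max.
Proof.
rewrite big_ord_recr; congr (_ + _); apply: eq_bigr => j _; congr g.
by apply: val_inj; rewrite /= /bump leqNgt ltn_ord.
Qed.

Section SumSet.
Variables T1 T2 : finType.
Implicit Types (A : {set T1}) (B : {set T2}).

(** The shape of the cones of a product fan, and of the sets of rays of [Z0 m n]. *)
Definition sumset A B : {set T1 + T2} :=
  [set x | match x with inl y => y \in A | inr z => z \in B end]%SET.

Lemma card_sumset A B : #|sumset A B| = (#|A| + #|B|)%N.
Proof.
rewrite -sum1_card big_sumType /= -!sum1_card.
by congr addn; apply: eq_bigl => x; rewrite inE.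
Qed.

Lemma sumsetU1l A B x : (inl x |: sumset A B)%SET = sumset (x |: A)%SET B.
Proof. by apply/setP => -[y|y]; rewrite !inE. Qed.

Lemma sumsetU1r A B x : (inr x |: sumset A B)%SET = sumset A (x |: B)%SET.
Proof. by apply/setP => -[y|y]; rewrite !inE. Qed.

End SumSet.

(** * Linear equivalence and nef divisors on a fan *)

(** A map of rays induced by a lattice map pulls characters back to characters.
    This covers isomorphisms and the inclusions of the factors of a product. *)
Lemma lin_equiv_restrict (K : numDomainType) (X Y : fan)
    (f : fray X -> fray Y) (P : 'M[int]_(fdim X, fdim Y)) (D E : tdiv K Y) :
    (forall i, fgen (f i) = fgen i *m P) ->
  lin_equiv D E -> lin_equiv (X := X) (fun i => D (f i)) (fun i => E (f i)).
Proof.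
move=> fP [u Du]; exists (map_mx intr P *m u) => i.
by rewrite Du fP map_mxM mulmxA.
Qed.

(** A linear relation between the ray generators is orthogonal to the divisors of
    characters, so it defines a functional on divisor classes. *)
Lemma lin_equiv_relation (K : numDomainType) (X : fan) (C : fray X -> int)
    (D E : tdiv K X) :
    \sum_i C i *: fgen i = 0 -> lin_equiv D E ->
  \sum_i D i * (C i)%:~R = \sum_i E i * (C i)%:~R.
Proof.
move=> C0 [u Du]; apply/subr0_eq; rewrite -sumrB.
transitivity ((map_mx intr (\sum_i C i *: fgen i) *m u) 0 0); last first.
  by rewrite C0 map_mx0 mul0mx mxE.
rewrite raddf_sum mulmx_suml summxE; apply: eq_bigr => i _.
by rewrite /= -mulrBl Du map_mxZ -scalemxAl [RHS]mxE mulrC.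
Qed.

Lemma intersection_lin_equiv (X : fan) (C : fray X -> int) (D E : tdiv int X) :
    \sum_i C i *: fgen i = 0 -> lin_equiv D E ->
  intersection D C = intersection E C.
Proof.
move=> C0 DE; have := lin_equiv_relation C0 DE.
by under eq_bigr do rewrite intz; under [RHS]eq_bigr do rewrite intz.
Qed.

(** Sections of the line bundle without common zero: the orbit of the cone [A] is
    missed by the effective divisor [D].  Unlike nefness, this pulls back to
    products without any dimension count. *)
Definition globally_generated (X : fan) (E : tdiv int X) : Prop :=
  forall A : {set fray X}, A \in fcones X ->
  exists D : tdiv int X,
    [/\ lin_equiv D E, forall i, 0 <= D i & forall i, i \in A -> D i = 0].

(** For a wall between the maximal cones through [v] and [v'], replace the divisor
    by an effective one vanishing on the first cone: only its coefficient at
    [v'] contributes to the intersection number. *)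
Lemma globally_generated_nef (X : fan) (E : tdiv int X) :
  globally_generated E -> nef E.
Proof.
move=> gE C [t [v [v' [_ [vt v't vv'] [vtX _] [_ Cv' Cout] C0]]]].
have [D [DE D_ge0 D0]] := gE _ vtX.
rewrite -(intersection_lin_equiv C0 DE) /intersection.
rewrite (bigD1 v') //= Cv' mulr1 big1 ?addr0 // => i iv'.
have [it|it] := boolP (i \in (v |: t)%SET); first by rewrite D0 // mul0r.
by rewrite Cout ?mulr0 // !inE (negbTE iv') orFb -in_setU1.
Qed.

Lemma globally_generated_restrict (X Y : fan) (f : fray X -> fray Y)
    (P : 'M[int]_(fdim X, fdim Y)) (E : tdiv int Y) :
    (forall i, fgen (f i) = fgen i *m P) ->
    (forall A : {set fray X}, A \in fcones X -> (f @: A)%SET \in fcones Y) ->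
  globally_generated E -> globally_generated (fun i => E (f i)).
Proof.
move=> fP fcone gE A AX; have [D [DE D_ge0 D0]] := gE _ (fcone _ AX).
exists (fun i => D (f i)); split=> //; first exact: lin_equiv_restrict fP DE.
by move=> i iA; apply/D0/imset_f.
Qed.

Lemma globally_generated0 (X : fan) : globally_generated (X := X) (fun=> 0).
Proof.
move=> A _; exists (fun=> 0); split=> //.
by exists 0 => i; rewrite subr0 mulmx0 mxE.
Qed.

(** * Bounds on decompositions of the anticanonical class *)

(** A cone of maximal dimension in [Y] is what turns a wall of [X] into a wall of
    [X x Y]. *)
Definition has_full_cone (X : fan) : Prop :=
  exists2 A : {set fray X}, A \in fcones X & #|A| = fdim X.

Section TauBounds.
Variables (R : realType) (K : numDomainType) (iota : K -> R).

Definition decomposition (X : fan) (r : nat) (a : 'I_r -> K)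
    (E : 'I_r -> tdiv int X) : Prop :=
  lin_equiv (fun i => (anticanonical X i)%:~R : K)
            (fun i => \sum_(k < r) a k * (E k i)%:~R).

(** Vanishing summands are tolerated outside the counted set [S], because a
    nonzero divisor on a product may restrict to zero on one of the factors. *)
Definition tau_le (X : fan) (t : R) : Prop :=
  forall (r : nat) (a : 'I_r -> K) (E : 'I_r -> tdiv int X) (S : {set 'I_r}),
    (forall k, 0 < a k) -> (forall k, nef (E k)) -> decomposition a E ->
    (forall k, k \in S -> ~ lin_equiv (E k) (fun=> 0)) ->
  \sum_(k in S) iota (a k) <= t.

(** A decomposition of total weight [t], with globally generated summands so that
    it can be pulled back to products. *)
Definition tau_ge (X : fan) (t : R) : Prop :=
  exists (r : nat) (a : 'I_r -> K) (E : 'I_r -> tdiv int X),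
    [/\ forall k, 0 < a k,
        forall k, globally_generated (E k) /\ ~ lin_equiv (E k) (fun=> 0),
        decomposition a E & t = \sum_(k < r) iota (a k)].

Definition tau_exact (X : fan) (t : R) : Prop :=
  [/\ has_full_cone X, tau_le X t & tau_ge X t].

Lemma gongyo_bounds (X : fan) (t : R) :
  tau_le X t -> tau_ge X t -> gongyo iota (anticanonical X) = t%:E.
Proof.
move=> tle [r [a [E [a0 gE dE tE]]]]; apply/eqP; rewrite eq_le; apply/andP; split.
  apply: ge_ereal_sup => _ [r' [a' [E' [a'0 nE' dE' ->]]]].
  rewrite lee_fin.
  have := tle r' a' E' finset.setT a'0 (fun k => (nE' k).1) dE'.
  have -> : \sum_(k < r') iota (a' k) = \sum_(k in [set: 'I_r']%SET) iota (a' k).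
    by apply: eq_bigl => k; rewrite finset.in_setT.
  by apply=> k _; apply: (nE' k).2.
apply: ereal_sup_ubound; exists r, a, E; split; rewrite ?tE // => k.
by have [gEk nEk] := gE k; split=> //; apply: globally_generated_nef.
Qed.

End TauBounds.

(** The upper bounds all come from one functional: intersect the decomposition
    with a relation [C] that is at least [d] on every nonzero nef divisor.  Then
    [d] times the sum of the counted coefficients is at most [- K . C], the sum of the
    entries of [C].  How this bounds the coefficients depends on whether they are
    integral, hence the last hypothesis. *)
Lemma tau_le_relation (R : realType) (K : numDomainType)
    (iota : {rmorphism K -> R}) (X : fan) (C : fray X -> int) (d : int) (t : R) :
    \sum_i C i *: fgen i = 0 -> 0 <= d ->
    (forall E : tdiv int X, nef E -> ~ lin_equiv E (fun=> 0) ->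
       d <= intersection E C) ->
    (forall x : K, d%:~R * x <= (\sum_i C i)%:~R -> iota x <= t) ->
  tau_le iota X t.
Proof.
move=> C0 d_ge0 dC dt r a E S a0 nE dE nzE.
rewrite -raddf_sum; apply: dt.
have -> : (\sum_i C i)%:~R = \sum_k a k * (intersection (E k) C)%:~R.
  have := lin_equiv_relation C0 dE.
  under eq_bigr do rewrite mul1r; rewrite -raddf_sum => ->.
  under eq_bigr do rewrite mulr_suml.
  rewrite exchange_big; apply: eq_bigr => k _; rewrite raddf_sum mulr_sumr.
  by apply: eq_bigr => i _; rewrite /= intrM mulrA.
rewrite [leRHS](bigID (mem S)) /= mulr_sumr -[leLHS]addr0 lerD //.
  apply: ler_sum => k kS; rewrite mulrC ler_pM2l // ler_int.
  by apply: dC (nE k) (nzE k kS).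
apply: sumr_ge0 => k _; apply: mulr_ge0; [exact: ltW | rewrite ler0z].
have [E0|nzk] := pselect (lin_equiv (E k) (fun=> 0)); last first.
  by apply: le_trans d_ge0 (dC _ (nE k) nzk).
rewrite (intersection_lin_equiv C0 E0) /intersection big1 // => i _.
by rewrite mul0r.
Qed.

(** * Invariance under isomorphism *)

(** A wall of [Y] is transported to a wall of [X]; the dimensions agree because a
    matrix with a two-sided inverse over the integers is square. *)
Lemma nef_iso (X Y : fan) (P : 'M[int]_(fdim X, fdim Y))
    (Q : 'M[int]_(fdim Y, fdim X)) (f : fray X -> fray Y)
    (g : fray Y -> fray X) (E : tdiv int X) :
    P *m Q = 1%:M -> Q *m P = 1%:M -> cancel f g -> cancel g f ->
    (forall i, fgen (f i) = fgen i *m P) ->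
    (forall A : {set fray X}, ((f @: A)%SET \in fcones Y) = (A \in fcones X)) ->
  nef E -> nef (X := Y) (fun j => E (g j)).
Proof.
move=> PQ QP fK gK fP fcone nE C.
move=> [t [v [v' [[tY tdim] [vt v't vv'] [vtY v'tY] [Cv Cv' Cout] C0]]]].
have gI := can_inj gK.
have fg (A : {set fray Y}) : (f @: (g @: A))%SET = A.
  by rewrite -imset_comp -[RHS]imset_id; apply: eq_imset.
have dimXY : fdim X = fdim Y.
  by apply/eqP; rewrite eqn_leq (mulmx1_min PQ) (mulmx1_min QP).
have -> : intersection (fun j => E (g j)) C = intersection E (fun i => C (f i)).
  rewrite /intersection (reindex f) /=; last by exists g => i _; [apply: fK | apply: gK].
  by apply: eq_bigr => i _; rewrite fK.
apply: nE; exists (g @: t)%SET, (g v), (g v'); split.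
- by rewrite -fcone fg card_imset // dimXY.
- by rewrite !mem_imset //; split=> //; rewrite (inj_eq gI).
- by rewrite -!imsetU1 -!fcone !fg.
- split; rewrite ?gK // => i; rewrite -!imsetU1 -{1}[i]fK mem_imset //.
  exact: Cout.
- have -> : \sum_i C (f i) *: fgen i = (\sum_j C j *: fgen j) *m Q.
    rewrite mulmx_suml (reindex f) /=; last by exists g => i _; [apply: fK | apply: gK].
    by apply: eq_bigr => i _; rewrite -scalemxAl fP -mulmxA PQ mulmx1.
  by rewrite C0 mul0mx.
Qed.

Section TauExact.
Variables (R : realType) (K : numDomainType) (iota : K -> R).

Lemma gongyo_iso (X Y : fan) (t : R) :
  fan_iso X Y -> tau_exact iota Y t -> gongyo iota (anticanonical X) = t%:E.
Proof.
move=> [P [Q [f [[PQ QP] [g fK gK] fP fcone]]]] [_ tle [r [a [E [a0 gE dE tE]]]]].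
have gQ j : fgen (g j) = fgen j *m Q by rewrite -[in RHS](gK j) fP -mulmxA PQ mulmx1.
apply: gongyo_bounds.
- move=> r' a' E' S a'0 nE' dE' nzE'.
  apply: (tle r' a' (fun k j => E' k (g j))) => //.
  + by move=> k; apply: (nef_iso PQ QP fK gK fP fcone).
  + exact: lin_equiv_restrict gQ dE'.
  + move=> k kS /(lin_equiv_restrict fP) E0; apply: (nzE' k kS).
    by have [u uE] := E0; exists u => i; rewrite -uE fK.
- exists r, a, (fun k i => E k (f i)); split=> //.
  + move=> k; have [gEk nzEk] := gE k; split.
      by apply: globally_generated_restrict fP _ gEk => A; rewrite fcone.
    move=> /(lin_equiv_restrict gQ) E0; apply: nzEk.
    by have [u uE] := E0; exists u => i; rewrite -uE gK.
  + exact: lin_equiv_restrict fP dE.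
Qed.

Lemma tau_exact_pt : tau_exact iota fan_pt 0.
Proof.
split.
- by exists finset.set0; rewrite ?cards0 // inE.
- move=> r a E S _ _ _ nz; rewrite big1 // => k /nz[].
  by exists 0; case.
- exists 0%N, (fun=> 1), (fun=> fun=> 0); split=> //; try by case.
    by exists 0; case.
  by rewrite big_ord0.
Qed.

End TauExact.

(** * Products *)

Section Product.
Variables X Y : fan.
Local Notation XY := (fan_prod X Y).

Lemma fgen_inl (i : fray X) :
  @fgen XY (inl i) = fgen i *m (row_mx 1%:M 0 : 'M[int]_(fdim X, fdim X + fdim Y)).
Proof. by rewrite mul_mx_row mulmx1 mulmx0. Qed.

Lemma fgen_inr (j : fray Y) :
  @fgen XY (inr j) = fgen j *m (row_mx 0 1%:M : 'M[int]_(fdim Y, fdim X + fdim Y)).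
Proof. by rewrite mul_mx_row mulmx1 mulmx0. Qed.

Lemma sumset_cone (A : {set fray X}) (B : {set fray Y}) :
  (sumset A B \in fcones XY) = (A \in fcones X) && (B \in fcones Y).
Proof.
rewrite inE.
have -> : (inl @^-1: sumset A B)%SET = A by apply/setP => x; rewrite !inE.
by have -> : (inr @^-1: sumset A B)%SET = B by apply/setP => x; rewrite !inE.
Qed.

Lemma has_full_cone_prod :
  has_full_cone X -> has_full_cone Y -> has_full_cone XY.
Proof.
move=> [A AX Adim] [B BY Bdim]; exists (sumset A B); first by rewrite sumset_cone AX.
by rewrite card_sumset Adim Bdim.
Qed.

(** The wall [t] of [X] becomes the wall [t x B] of the product for any maximal
    cone [B] of [Y], and the rays of [Y] get coefficient [0] in the relation. *)
Lemma nef_inl (E : tdiv int XY) :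
  has_full_cone Y -> nef E -> nef (fun i => E (inl i)).
Proof.
move=> [B BY Bdim] nE C [t [v [v' [[tX tdim] [vt v't vv'] [vtX v'tX] [Cv Cv' Cout] C0]]]].
pose C' (x : fray XY) : int := if x is inl i then C i else 0.
have -> : intersection (fun i => E (inl i)) C = intersection E C'.
  rewrite /intersection big_sumType /= [X in _ = _ + X]big1 ?addr0 //.
  by move=> j _; rewrite mulr0.
apply: nE; exists (sumset t B), (inl v), (inl v'); split.
- by rewrite sumset_cone tX BY card_sumset -addSn tdim Bdim.
- by rewrite !inE.
- by rewrite !sumsetU1l !sumset_cone vtX v'tX BY.
- by split=> // -[i|//]; rewrite !sumsetU1l inE; apply: Cout.
- rewrite big_sumType /= [X in _ + X]big1 ?addr0; last by move=> j _; rewrite scale0r.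
  transitivity (row_mx (\sum_i C i *: fgen i) (0 : 'rV[int]_(fdim Y))).
    have -> : row_mx (\sum_i C i *: fgen i) 0 =
        (\sum_i C i *: fgen i) *m (row_mx 1%:M 0 : 'M[int]_(fdim X, fdim X + fdim Y)).
      by rewrite mul_mx_row mulmx1 mulmx0.
    by rewrite mulmx_suml; apply: eq_bigr => i _; rewrite -scalemxAl -fgen_inl.
  by rewrite C0 row_mx0.
Qed.

Lemma nef_inr (E : tdiv int XY) :
  has_full_cone X -> nef E -> nef (fun i => E (inr i)).
Proof.
move=> [B BX Bdim] nE C [t [v [v' [[tY tdim] [vt v't vv'] [vtY v'tY] [Cv Cv' Cout] C0]]]].
pose C' (x : fray XY) : int := if x is inr i then C i else 0.
have -> : intersection (fun i => E (inr i)) C = intersection E C'.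
  rewrite /intersection big_sumType /= [X in _ = X + _]big1 ?add0r //.
  by move=> j _; rewrite mulr0.
apply: nE; exists (sumset B t), (inr v), (inr v'); split.
- by rewrite sumset_cone tY BX card_sumset -addnS tdim Bdim.
- by rewrite !inE.
- by rewrite !sumsetU1r !sumset_cone vtY v'tY BX.
- by split=> // -[//|i]; rewrite !sumsetU1r inE; apply: Cout.
- rewrite big_sumType /= [X in X + _]big1 ?add0r; last by move=> j _; rewrite scale0r.
  transitivity (row_mx (0 : 'rV[int]_(fdim X)) (\sum_i C i *: fgen i)).
    have -> : row_mx 0 (\sum_i C i *: fgen i) =
        (\sum_i C i *: fgen i) *m (row_mx 0 1%:M : 'M[int]_(fdim Y, fdim X + fdim Y)).
      by rewrite mul_mx_row mulmx1 mulmx0.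
    by rewrite mulmx_suml; apply: eq_bigr => i _; rewrite -scalemxAl -fgen_inr.
  by rewrite C0 row_mx0.
Qed.

Definition div_prod (K : Type) (D : tdiv K X) (E : tdiv K Y) : tdiv K XY :=
  fun x => match x with inl i => D i | inr j => E j end.

Lemma lin_equiv_prod (K : numDomainType) (D E : tdiv K XY) :
    lin_equiv (fun i => D (inl i)) (fun i => E (inl i)) ->
    lin_equiv (fun j => D (inr j)) (fun j => E (inr j)) ->
  lin_equiv D E.
Proof.
move=> [u uD] [w wD]; exists (col_mx u w) => -[i|j] /=.
  by rewrite uD map_row_mx map_mx0 mul_row_col mul0mx addr0.
by rewrite wD map_row_mx map_mx0 mul_row_col mul0mx add0r.
Qed.

Lemma globally_generated_prod (D : tdiv int X) (E : tdiv int Y) :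
    globally_generated D -> globally_generated E ->
  globally_generated (div_prod D E).
Proof.
move=> gD gE A; rewrite inE => /andP[AX AY].
have [D' [D'D D'_ge0 D'0]] := gD _ AX; have [E' [E'E E'_ge0 E'0]] := gE _ AY.
exists (div_prod D' E'); split; first exact: lin_equiv_prod.
  by case.
by case=> i iA /=; [apply: D'0 | apply: E'0]; rewrite inE.
Qed.

Section Tau.
Variables (R : realType) (K : numDomainType) (iota : K -> R).
Hypothesis iota_ge0 : forall x, 0 < x -> 0 <= iota x.

(** A summand which is nonzero on the product is nonzero on one of the factors, so
    its coefficient is counted in at least one of the two sums. *)
Lemma tau_le_prod (t t' : R) :
    has_full_cone X -> has_full_cone Y ->
    tau_le iota X t -> tau_le iota Y t' -> tau_le iota XY (t + t').
Proof.
move=> fX fY tleX tleY r a E S a0 nE dE nzE.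
pose S1 := [set k in S | `[< ~ lin_equiv (X := X) (fun i => E k (inl i)) (fun=> 0) >]]%SET.
pose S2 := [set k in S | `[< ~ lin_equiv (X := Y) (fun j => E k (inr j)) (fun=> 0) >]]%SET.
have le1 : \sum_(k in S1) iota (a k) <= t.
  apply: tleX (a0) _ (lin_equiv_restrict fgen_inl dE) _ => k.
    exact: nef_inl.
  by rewrite inE => /andP[_ /asboolP].
have le2 : \sum_(k in S2) iota (a k) <= t'.
  apply: tleY (a0) _ (lin_equiv_restrict fgen_inr dE) _ => k.
    exact: nef_inr.
  by rewrite inE => /andP[_ /asboolP].
apply: le_trans (lerD le1 le2).
rewrite [X in _ <= X + _]big_mkcond [X in _ <= _ + X]big_mkcond [X in X <= _]big_mkcond -big_split /=.

apply: ler_sum => k _; have ak := iota_ge0 (a0 k).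
have [kS|kS] := boolP (k \in S); last first.
  by rewrite /S1 /S2 !inE (negbTE kS) addr0.
have [k1|k1] := boolP (k \in S1); have [k2|k2] := boolP (k \in S2);
  rewrite ?addr0 ?add0r ?lerDl //.
case: (nzE k kS); move: k1 k2; rewrite !inE kS /= => /asboolPn/contrapT E1 /asboolPn/contrapT E2.
exact: lin_equiv_prod.
Qed.

Lemma tau_ge_prod (t t' : R) :
  tau_ge iota X t -> tau_ge iota Y t' -> tau_ge iota XY (t + t').
Proof.
move=> [r [a [D [a0 gD dD ->]]]] [r' [a' [E [a'0 gE dE ->]]]].
pose b (k : 'I_(r + r')) := match fintype.split k with inl i => a i | inr j => a' j end.
pose F (k : 'I_(r + r')) : tdiv int XY :=
  match fintype.split k with
  | inl i => div_prod (D i) (fun=> 0) | inr j => div_prod (fun=> 0) (E j)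
  end.
have bF (V : nmodType) (h : K -> tdiv int XY -> V) :
    \sum_k h (b k) (F k) = \sum_i h (a i) (div_prod (D i) (fun=> 0))
                         + \sum_j h (a' j) (div_prod (fun=> 0) (E j)).
  rewrite big_split_ord; congr (_ + _); apply: eq_bigr => i _; rewrite /b /F.
    by rewrite (unsplitK (inl i)).
  by rewrite (unsplitK (inr i)).
exists (r + r')%N, b, F; split.
- by move=> k; rewrite /b; case: fintype.split.
- move=> k; rewrite /F; case: fintype.split => i.
    have [gDi nzDi] := gD i; split.
      exact: globally_generated_prod gDi (@globally_generated0 Y).
    by move=> /(lin_equiv_restrict fgen_inl).
  have [gEi nzEi] := gE i; split.
    exact: globally_generated_prod (@globally_generated0 X) gEi.
  by move=> /(lin_equiv_restrict fgen_inr).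
- apply: lin_equiv_prod.
    have [u uD] := dD; exists u => i; rewrite -uD; congr (_ - _).
    rewrite (bF K (fun x G => x * (G (inl i))%:~R)) [X in _ + X]big1 ?addr0 //.
    by move=> j _; rewrite mulr0.
  have [u uE] := dE; exists u => i; rewrite -uE; congr (_ - _).
  rewrite (bF K (fun x G => x * (G (inr i))%:~R)) [X in X + _]big1 ?add0r //.
  by move=> j _; rewrite mulr0.
- by rewrite (bF R (fun x _ => iota x)).
Qed.

Lemma tau_exact_prod (t t' : R) :
  tau_exact iota X t -> tau_exact iota Y t' -> tau_exact iota XY (t + t').
Proof.
move=> [fX leX geX] [fY leY geY]; split; first exact: has_full_cone_prod.
  exact: tau_le_prod.
exact: tau_ge_prod.
Qed.

End Tau.
End Product.

Lemma tau_exact_bigprod (R : realType) (K : numDomainType) (iota : K -> R)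
    (I : finType) (F : I -> fan) (t : I -> R) :
    (forall x, 0 < x -> 0 <= iota x) ->
    (forall i, tau_exact iota (F i) (t i)) ->
  tau_exact iota (\big[fan_prod/fan_pt]_i F i) (\sum_i t i).
Proof.
move=> iota_ge0 tF; apply: (big_ind2 (tau_exact iota)) => //.
  exact: tau_exact_pt.
by move=> *; apply: tau_exact_prod.
Qed.

(** * The projective line *)

(** The class of the line itself as a curve, on which a point has degree [1]. *)
Lemma P1_relation : \sum_(e : fray P1) (1 : int) *: fgen e = 0.
Proof. by rewrite big_bool /= !scale1r subrr. Qed.

Lemma P1_character (K : numDomainType) (c : K) (e : fray P1) :
  (map_mx intr (fgen e) *m (const_mx c : 'cV_(fdim P1))) 0 0 = if e then c else - c.
Proof.
rewrite !mxE big_ord1; case: e; rewrite !mxE ?mul1r //.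
by rewrite mulN1r.
Qed.

Lemma tau_exact_P1 (R : realType) (K : numDomainType)
    (iota : {rmorphism K -> R}) :
  {homo iota : x y / x <= y} -> tau_exact iota P1 2.
Proof.
move=> iota_le; split.
- by exists [set true]%SET; rewrite ?inE cards1.
- apply: (@tau_le_relation _ _ _ _ _ 1 _ P1_relation) => // [E nE nzE|x].
    have E_ge0 : 0 <= intersection E (fun=> 1).
      apply: nE; exists finset.set0, true, false; split=> //.
      + by rewrite inE cards0.
      + by rewrite !inE.
      + by rewrite !finset.setU0 !inE !cards1.
      + by split=> // -[]; rewrite !inE.
      + exact: P1_relation.
    rewrite -gtz0_ge1 lt_def E_ge0 andbT; apply/eqP => E0; apply: nzE.
    exists (const_mx (E true)) => -[]; rewrite subr0 P1_character //.
    move: E0; rewrite /intersection big_bool /= !mulr1 addrC => /eqP.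
    by rewrite addr_eq0 => /eqP.
  by rewrite big_bool /= mul1r => /iota_le; rewrite (rmorph_nat iota 2).
- pose pt : tdiv int P1 := fun e => e%:R.
  exists 2%N, (fun=> 1), (fun=> pt); split=> //.
  + move=> _; split.
      move=> A; rewrite inE => A1; have [At|At] := boolP (true \in A).
        exists (fun e => (~~ e)%:R); split; [|by case|].
          exists (const_mx (-1)) => -[]; rewrite P1_character /pt /=; ring.
        by case=> // Af; rewrite (cardsD1 true) At (cardsD1 false) !inE Af in A1.
      exists pt; split; [|by case|by case=> //; rewrite (negbTE At)].
      by exists 0 => e; rewrite subrr mulmx0 mxE.
    move=> /(intersection_lin_equiv P1_relation).
    by rewrite /intersection !big_bool.
  + exists (const_mx (-1)) => -[]; rewrite P1_character !big_ord_recl big_ord0 /pt /=; ring.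
  + by rewrite !big_ord_recl big_ord0 rmorph1 addr0.
Qed.

(** * Divisor classes and nef divisors on [Z0 m n] *)

Section Z0.
Variables (m n : nat).
Hypotheses (m_gt0 : (0 < m)%N) (n_ge : (2 * m <= n)%N) (n_le : (n <= (2 * m).+1)%N).
Local Notation Z := (Z0 m n).
Local Notation idx := (@Z0idx m n).

Lemma Z0idx_inj : injective idx.
Proof.
move=> i j /(congr1 val); rewrite /= !inordK ?(leq_trans (ltn_ord _)) //.
exact: val_inj.
Qed.

(** This relation makes [degree] an invariant of the class, and it is the only
    constraint on the values of a character at the [x_j]. *)
Lemma sum_xgen : \sum_j @xgen m j = 0.
Proof.
rewrite sum_lift_max /xgen unlift_none; under eq_bigr do rewrite liftK.
apply/rowP => i; rewrite mxE summxE (bigD1 i) //= !mxE !eqxx big1 ?addr0 ?subrr //.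
by move=> j ji; rewrite mxE eqxx eq_sym (negbTE ji).
Qed.

Lemma xgen_character (K : numDomainType) (g : 'I_(2 * m).+1 -> K) :
  \sum_j g j = 0 ->
  exists u : 'cV[K]_(2 * m), forall j, (map_mx intr (xgen j) *m u) 0 0 = g j.
Proof.
rewrite sum_lift_max => g0; exists (\col_i g (lift ord_max i)) => j.
rewrite /xgen; case: unliftP => [i|] ->.
  by rewrite map_delta_mx -rowE !mxE.
rewrite mxE -[RHS](addKr (\sum_i g (lift ord_max i))) g0 addr0 -sumrN.
by apply: eq_bigr => i _; rewrite !mxE rmorphN mulN1r.
Qed.

Definition width (V : zmodType) (E : fray Z -> V) (i : 'I_n) : V :=
  E (inl (idx i)) + E (inr i).

Definition degree (V : zmodType) (E : fray Z -> V) : V := \sum_j E (inl j).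

Lemma Z0_lin_equiv (K : numDomainType) (D E : tdiv K Z) :
  width D =1 width E -> degree D = degree E -> lin_equiv D E.
Proof.
move=> DE_width DE_degree.
have [|u uE] := @xgen_character K (fun j => D (inl j) - E (inl j)).
  by rewrite sumrB; apply/eqP; rewrite subr_eq0; apply/eqP.
exists u => -[j|i]; first by rewrite uE.
rewrite map_mxN mulNmx mxE uE; have := DE_width i; rewrite /width => w.
by rewrite opprB -[D (inr i)](addKr (D (inl (idx i)))) w; ring.
Qed.

(** Every primitive collection other than [{x_i, y_i}] has [m + 1] elements, all
    of them [x]'s or all of them [y]'s. *)
Lemma Z0_cone (A : {set 'I_(2 * m).+1}) (B : {set 'I_n}) :
    (#|A| <= m)%N -> (#|B| <= m)%N -> (forall i, i \in B -> idx i \notin A) ->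
  sumset A B \in fcones Z.
Proof.
move=> Am Bm BA; rewrite inE; apply/forall_inP => P; rewrite inE.
case/or3P=> /existsP[I].
- move/eqP=> ->; apply/negP; rewrite finset.subUset !finset.sub1set !inE => /andP[+ /BA].
  by move=> ->.
- case/andP=> /eqP Im /eqP ->; apply/negP => sub.
  have : ~: (idx @: I) \subset A.
    apply/fintype.subsetP => j jI; have := fintype.subsetP sub (inl j).
    by rewrite inE; apply; apply: imset_f.
  move/subset_leq_card; rewrite cardsCs finset.setCK card_imset ?Im; last exact: Z0idx_inj.
  by rewrite card_ord => /leq_trans/(_ Am); lia.
- case/andP=> /eqP Im /eqP ->; apply/negP => sub.
  have : I \subset B.
    apply/fintype.subsetP => j jI; have := fintype.subsetP sub (inr j).
    by rewrite inE; apply; apply: imset_f.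
  by move/subset_leq_card; rewrite Im => /leq_trans/(_ Bm); rewrite ltnn.
Qed.

(** The relation [sum_(j not in T) x_j = sum_(i in T) y_i]. *)
Definition primitive_class (T : {set 'I_n}) (x : fray Z) : int :=
  match x with
  | inl j => (j \notin idx @: T)%:R
  | inr i => - (i \in T)%:R
  end.

Lemma sum_out_image (V : zmodType) (T : {set 'I_n}) (g : 'I_(2 * m).+1 -> V) :
  \sum_(j | j \notin (idx @: T)%SET) g j = \sum_j g j - \sum_(i in T) g (idx i).
Proof.
rewrite [in RHS](bigID (mem (idx @: T)%SET)) /= big_imset /=; last by move=> ? ? _ _ /Z0idx_inj.
by rewrite addrC addrK.
Qed.

Lemma primitive_class_relation (T : {set 'I_n}) : \sum_x primitive_class T x *: fgen x = 0.
Proof.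
rewrite big_sumType /=.
have -> : \sum_j (j \notin idx @: T)%:R *: @xgen m j = \sum_(j | j \notin (idx @: T)%SET) xgen j.
  by rewrite [RHS]big_mkcond; apply: eq_bigr => j _; case: ifP; rewrite ?scale1r ?scale0r.
rewrite sum_out_image sum_xgen sub0r addrC; apply/eqP; rewrite subr_eq0; apply/eqP.
rewrite [RHS]big_mkcond; apply: eq_bigr => i _.
by case: ifP; rewrite ?oppr0 ?scale0r // scalerN scaleNr scale1r opprK.
Qed.

Lemma intersection_primitive_class (E : tdiv int Z) (T : {set 'I_n}) :
  intersection E (primitive_class T) = degree E - \sum_(i in T) width E i.
Proof.
rewrite /intersection big_sumType /=.
have -> : \sum_j E (inl j) * (j \notin idx @: T)%:R = \sum_(j | j \notin (idx @: T)%SET) E (inl j).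
  by rewrite [RHS]big_mkcond; apply: eq_bigr => j _; case: ifP; rewrite ?mulr1 ?mulr0.
rewrite sum_out_image big_split opprD addrA /=; congr (_ + _).
rewrite -sumrN [RHS]big_mkcond; apply: eq_bigr => i _.
by case: ifP; rewrite ?mulr0 ?oppr0 // mulrN mulr1.
Qed.

Lemma card_out_image (T : {set 'I_n}) : #|~: (idx @: T)%SET| = ((2 * m).+1 - #|T|)%N.
Proof. by rewrite cardsCs finset.setCK card_imset ?card_ord //; apply: Z0idx_inj. Qed.

(** The relation of [S] is that of the curve whose wall consists of the [y_i],
    [i] in [S], and of all but two of the [m + 1] complementary [x_j]. *)
Lemma nef_width_le_degree (E : tdiv int Z) (S : {set 'I_n}) :
  nef E -> #|S| = m -> \sum_(i in S) width E i <= degree E.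
Proof.
move=> nE Sm; rewrite -subr_ge0 -intersection_primitive_class; apply: nE.
set A := (~: (idx @: S))%SET.
have Am : #|A| = m.+1 by rewrite card_out_image Sm; lia.
have /card_gt1P[v [v' [vA v'A vv']]] : (1 < #|A|)%N by rewrite Am.
have D1 x : x \in A -> #|(A :\ x)%SET| = m.
  by move=> xA; have := cardsD1 x A; rewrite Am xA => -[].
have D2 : #|(A :\ v :\ v')%SET|.+1 = m.
  by apply: succn_inj; rewrite card_setD2.
have cone x : x \in A -> sumset (A :\ x)%SET S \in fcones Z.
  move=> xA; apply: Z0_cone; rewrite ?D1 ?Sm // => i iS.
  by rewrite !inE imset_f // andbF.
have Dv : (v |: (A :\ v :\ v'))%SET = (A :\ v')%SET by rewrite setD2K.
have Dv' : (v' |: (A :\ v :\ v'))%SET = (A :\ v)%SET.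
  by rewrite setD2Kr.
exists (sumset (A :\ v :\ v')%SET S), (inl v), (inl v'); split.
- split; last by rewrite card_sumset Sm -addSn D2 /= mulSn mul1n.
  apply: Z0_cone => [||i iS]; [by rewrite ltnW // D2 | by rewrite Sm |].
  by rewrite !inE imset_f // !andbF.
- by split; rewrite ?inE ?finset.in_setD1 ?eqxx ?andbF.
- by rewrite !sumsetU1l Dv Dv' !cone.
- split; first by move: vA; rewrite inE /= => ->.
    by move: v'A; rewrite inE /= => ->.
  case=> i; rewrite !sumsetU1l Dv' finset.setD1K // inE /=.
    by rewrite inE negbK => ->.
  by move/negbTE=> ->; rewrite oppr0.
- exact: primitive_class_relation.
Qed.

(** The opposite of the relation of [T] is that of the curve whose wall consists of
    all but two of the [y_i], [i] in [T], and of the [m] complementary [x_j]. *)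
Lemma nef_degree_le_width (E : tdiv int Z) (T : {set 'I_n}) :
  nef E -> #|T| = m.+1 -> degree E <= \sum_(i in T) width E i.
Proof.
move=> nE Tm; rewrite -subr_le0 -intersection_primitive_class -oppr_ge0.
have -> : - intersection E (primitive_class T) = intersection E (fun x => - primitive_class T x).
  by rewrite -sumrN; apply: eq_bigr => x _; rewrite mulrN.
apply: nE; set A := (~: (idx @: T))%SET.
have Am : #|A| = m by rewrite card_out_image Tm; lia.
have /card_gt1P[v [v' [vT v'T vv']]] : (1 < #|T|)%N by rewrite Tm.
have D1 x : x \in T -> #|(T :\ x)%SET| = m.
  by move=> xT; have := cardsD1 x T; rewrite Tm xT => -[].
have D2 : #|(T :\ v :\ v')%SET|.+1 = m.
  by apply: succn_inj; rewrite card_setD2.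
have cone x : x \in T -> sumset A (T :\ x)%SET \in fcones Z.
  move=> xT; apply: Z0_cone; rewrite ?D1 ?Am // => i.
  by rewrite !inE negbK => /andP[_ iT]; rewrite imset_f.
have Dv : (v |: (T :\ v :\ v'))%SET = (T :\ v')%SET by rewrite setD2K.
have Dv' : (v' |: (T :\ v :\ v'))%SET = (T :\ v)%SET.
  by rewrite setD2Kr.
exists (sumset A (T :\ v :\ v')%SET), (inr v), (inr v'); split.
- split; last by rewrite card_sumset Am -addnS D2 /= mulSn mul1n.
  apply: Z0_cone => [||i]; [by rewrite Am | by rewrite ltnW // D2 |].
  by rewrite !inE negbK => /and3P[_ _ iT]; rewrite imset_f.
- by split; rewrite ?inE ?finset.in_setD1 ?eqxx ?andbF.
- by rewrite !sumsetU1r Dv Dv' !cone.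
- split; rewrite /= ?vT ?v'T ?opprK //.
  case=> i; rewrite !sumsetU1r Dv' finset.setD1K // inE /=.
    by rewrite inE negbK => ->; rewrite oppr0.
  by move/negbTE=> ->; rewrite !oppr0.
- under eq_bigr do rewrite scaleNr.
  by rewrite sumrN primitive_class_relation oppr0.
Qed.

(** If [m] widths are positive, their sum is at least [m] and bounds the degree from
    below.  If not, at least [m + 1] of the [n >= 2m] widths vanish and force the
    degree to be nonpositive; then all sums of [m] widths, hence all widths and
    the degree, are zero. *)
Lemma nef_degree_ge (E : tdiv int Z) :
  nef E -> ~ lin_equiv E (fun=> 0) -> m%:Z <= degree E.
Proof.
move=> nE nzE.
have n_gt : (m < n)%N by lia.
(* Compare an [m]-set avoiding [i] with the same set enlarged by [i]. *)
have w_ge0 i : 0 <= width E i.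
  have [||S [_ SD Sm]] := @subset_between _ finset.set0 [set~ i]%SET m.
  - exact: finset.sub0set.
  - by rewrite cards0 cardsC1 card_ord; lia.
  have iS : i \notin S by apply/negP => /(fintype.subsetP SD); rewrite !inE eqxx.
  have := nef_width_le_degree nE Sm; have := @nef_degree_le_width E (i |: S)%SET nE.
  rewrite cardsU1 iS Sm => /(_ erefl); rewrite big_setU1 //= => le1 le2.
  by have := le_trans le2 le1; rewrite lerDr.
pose W := [set i | 1 <= width E i]%SET.
have [Wm|Wm] := leqP m #|W|.
  have [||S [_ SW Sm]] := @subset_between _ finset.set0 W m.
  - exact: finset.sub0set.
  - by rewrite cards0.
  apply: le_trans (nef_width_le_degree nE Sm).
  rewrite -Sm -sum1_card raddf_sum; apply: ler_sum => i iS.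
  by have := fintype.subsetP SW _ iS; rewrite inE.
have w0 i : i \notin W -> width E i = 0.
  rewrite inE -ltNge -[1]add0r ltzD1 => w_le0.
  by apply/eqP; rewrite eq_le w_le0 w_ge0.
have [||T [_ TW Tm]] := @subset_between _ finset.set0 (~: W)%SET m.+1.
- exact: finset.sub0set.
- by rewrite cards0 cardsCs finset.setCK card_ord; lia.
have degree_le0 : degree E <= 0.
  apply: le_trans (nef_degree_le_width nE Tm) _.
  rewrite big1 // => i iT; apply: w0; by have := fintype.subsetP TW _ iT; rewrite inE.
have w_le (S : {set 'I_n}) : #|S| = m -> \sum_(i in S) width E i <= 0.
  by move=> Sm; apply: le_trans (nef_width_le_degree nE Sm) degree_le0.
have sum_ge0 (S : {set 'I_n}) : 0 <= \sum_(i in S) width E i by apply: sumr_ge0.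
case: nzE; apply: Z0_lin_equiv => [i|].
  rewrite [RHS]addr0; apply/eqP; rewrite eq_le w_ge0 andbT.
  have [||S [iS _ Sm]] := @subset_between _ [set i]%SET [set: 'I_n]%SET m.
  - exact: finset.subsetT.
  - by rewrite cards1 cardsT card_ord; lia.
  rewrite finset.sub1set in iS; apply: le_trans (w_le S Sm).
  by rewrite (bigD1 i) //= lerDl sumr_ge0.
rewrite [RHS]big1 //; apply/eqP; rewrite eq_le degree_le0.
have [||S [_ _ Sm]] := @subset_between _ finset.set0 [set: 'I_n]%SET m.
- exact: finset.subsetT.
- by rewrite cards0 cardsT card_ord; lia.
by apply: le_trans (sum_ge0 S) (nef_width_le_degree nE Sm).
Qed.
End Z0.

(** * Slices of cubes and the value of [tau] on [Z0 m n] *)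

Section Z0tau.
Variables (m n : nat).
Hypotheses (m_gt0 : (0 < m)%N) (n_ge : (2 * m <= n)%N) (n_le : (n <= (2 * m).+1)%N).
Local Notation Z := (Z0 m n).
Local Notation idx := (@Z0idx m n).

Lemma Z0_cone_inv (A : {set fray Z}) (P : {set Z0ray m n}) :
  A \in fcones Z -> P \in Z0primitive m n -> ~~ (P \subset A).
Proof. by rewrite inE => /forall_inP; apply. Qed.

(** An effective divisor in the class of [E] is an integral point of the polytope,
    here a slice of a face of the unit cube: the coordinate [h j] is the
    coefficient of [x_j] and the slack [(idx i \in W)%:R - h (idx i)] that of
    [y_i].  Avoiding the orbit of [A] prescribes [h j = 0] for [x_j] in [A] and no
    slack for [y_i] in [A].  If some [x_j] without opposite ray [y_j] is not in
    [A], its coordinate is unbounded and absorbs the missing degree.  Otherwise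
    [A] has at most [m] of the [x]'s, so there is room for the indicator of a set
    of [k] indices. *)
Lemma Z0_globally_generated (E : tdiv int Z) (W : {set 'I_(2 * m).+1}) (k : nat) :
    (forall i, width E i = (idx i \in W)%:R) -> degree E = k%:R ->
    (m <= k)%N -> (k + m <= #|W|)%N ->
  globally_generated E.
Proof.
move=> E_width E_degree mk kW A /Z0_cone_inv prim.
pose XA := [set j | inl j \in A]%SET; pose YA := [set i | inr i \in A]%SET.
have XYA i : i \in YA -> idx i \notin XA.
  rewrite !inE => iA; apply: contraT; rewrite negbK => xA.
  have /prim : [set inl (idx i); inr i]%SET \in Z0primitive m n.
    by rewrite inE; apply/or3P/Or31/existsP; exists i.
  by rewrite finset.subUset !finset.sub1set xA iA.
have YAm : (#|YA| <= m)%N.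
  rewrite leqNgt; apply/negP => YAm.
  have [||J [_ JY Jm]] := @subset_between _ finset.set0 YA m.+1.
  - exact: finset.sub0set.
  - by rewrite cards0.
  have /prim/negP[] : (inr @: J)%SET \in Z0primitive m n.
    by rewrite inE; apply/or3P/Or33/existsP; exists J; rewrite Jm !eqxx.
  apply/fintype.subsetP => _ /imsetP[i iJ ->].
  by have := fintype.subsetP JY _ iJ; rewrite inE.
suff [h [h_sum h_ge0 hX h_le hY]] : exists h : 'I_(2 * m).+1 -> int,
    [/\ \sum_j h j = k%:R, forall j, 0 <= h j, forall j, j \in XA -> h j = 0,
        forall i, h (idx i) <= (idx i \in W)%:R
      & forall i, i \in YA -> h (idx i) = (idx i \in W)%:R].
  exists (fun x => match x with inl j => h j
                              | inr i => (idx i \in W)%:R - h (idx i) end); split.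
  - apply: Z0_lin_equiv => [i|]; last by rewrite E_degree.
    by rewrite E_width /width addrC subrK.
  - by case=> [j|i]; rewrite ?subr_ge0.
  - case=> [j|i] iA; first by apply: hX; rewrite inE.
    by rewrite hY ?subrr // inE.
(* The coordinates which are forced to be [1] by the [y_i] in [A]. *)
pose B := (W :&: (idx @: YA))%SET.
have Bk : (#|B| <= k)%N.
  apply: leq_trans (leq_trans YAm mk).
  by apply: leq_trans (subset_leq_card (finset.subsetIr _ _)) (leq_imset_card _ _).
have BX j : j \in XA -> j \notin B.
  move=> jX; rewrite inE negb_and; apply/orP; right; apply/negP => /imsetP[i iY ij].
  by have := XYA i iY; rewrite -ij jX.
have BY i : i \in YA -> (idx i \in B) = (idx i \in W).
  by move=> iY; rewrite inE imset_f // andbT.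
have [j0 /andP[j0idx j0A]|XA_full] :=
    pickP [pred j | (j \notin (idx @: [set: 'I_n])%SET) && (inl j \notin A)].
  have nj0 i : (idx i == j0) = false.
    by apply: contraNF j0idx => /eqP <-; apply: imset_f.
  exists (fun j => (j \in B)%:R + (j == j0)%:R * (k - #|B|)%:R); split.
  - rewrite big_split sum_indicator /= -mulr_suml.
    rewrite (bigD1 j0) //= eqxx big1 ?addr0 ?mul1r -?natrD ?subnKC //.
    by move=> j /negbTE ->.
  - by move=> j; rewrite addr_ge0 // mulr_ge0.
  - move=> j jX; rewrite (negbTE (BX _ jX)) add0r.
    case: eqVneq => [jj0|_]; last by rewrite mul0r.
    by move: jX j0A; rewrite inE jj0 => ->.
  - move=> i; rewrite nj0 mul0r addr0 ler_nat inE.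
    by case: (_ \in W) => //; case: (_ \in _).
  - by move=> i iY; rewrite nj0 mul0r addr0 BY.
(* All [x_j] without opposite lie in [A], so the complement of more than [m] of
   the [x_j] in [A] extends to a set of [m] indices of [y]'s, and the
   corresponding primitive collection would be contained in [A]. *)
have XAm : (#|XA| <= m)%N.
  rewrite leqNgt; apply/negP => XAm.
  pose I0 := (idx @^-1: ~: XA)%SET.
  have I0m : (#|I0| <= m)%N.
    rewrite -(card_imset (mem I0) (Z0idx_inj n_le)).
    have : ((idx @: I0) \subset ~: XA)%SET.
      by apply/fintype.subsetP => _ /imsetP[i iI ->]; rewrite inE in iI.
    move/subset_leq_card => /leq_trans; apply.
    by rewrite cardsCs finset.setCK card_ord; lia.
  have [||I [I0I _ Im]] := @subset_between _ I0 [set: 'I_n]%SET m.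
  - exact: finset.subsetT.
  - by rewrite I0m cardsT card_ord; lia.
  have /prim/negP[] : (inl @: ~: (idx @: I))%SET \in Z0primitive m n.
    by rewrite inE; apply/or3P/Or32/existsP; exists I; rewrite Im !eqxx.
  apply/fintype.subsetP => _ /imsetP[j jI ->]; apply: contraT => jA.
  have := XA_full j; rewrite /= jA andbT => /negbT; rewrite negbK => /imsetP[i _ ji].
  move: jI; rewrite inE ji imset_f //; apply: (fintype.subsetP I0I).
  by rewrite !inE -ji.
have [||T [BT TW Tk]] := @subset_between _ B (W :\: XA)%SET k.
- apply/fintype.subsetP => j jB; rewrite inE; apply/andP; split.
    by apply/negP => /BX; rewrite jB.
  by move: jB; rewrite inE => /andP[].
- rewrite Bk -(leq_add2r m) (leq_trans kW) // -(cardsID XA W) addnC leq_add2l.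
  exact: leq_trans (subset_leq_card (finset.subsetIr W XA)) XAm.
exists (fun j => (j \in T)%:R); split=> //.
- by rewrite sum_indicator Tk.
- move=> j jX; have := contra (fintype.subsetP TW j); rewrite inE jX => /(_ isT).
  by move/negbTE ->.
- move=> i; rewrite ler_nat; have := fintype.subsetP TW (idx i); rewrite inE.
  by case: (_ \in T) => // /(_ isT)/andP[_ ->].
- move=> i iY; congr (_ %:R); congr nat_of_bool; apply/idP/idP.
    by move/(fintype.subsetP TW); rewrite inE => /andP[].
  by rewrite -BY //; apply: (fintype.subsetP BT).
Qed.

(** A representative of the class of degree [k] whose widths are given by the
    indicator of [W]; placing the degree on the last [x] is arbitrary. *)
Definition slice (W : {set 'I_(2 * m).+1}) (k : nat) : tdiv int Z :=
  fun x => match x with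
           | inl j => (j == ord_max)%:R * k%:R
           | inr i => (idx i \in W)%:R - (idx i == ord_max)%:R * k%:R
           end.

Lemma width_slice W k i : width (slice W k) i = (idx i \in W)%:R.
Proof. by rewrite /width addrC subrK. Qed.

Lemma degree_slice W k : degree (slice W k) = k%:R.
Proof.
rewrite /degree /= -mulr_suml (bigD1 ord_max) //= eqxx big1 ?addr0 ?mul1r //.
by move=> j /negbTE ->.
Qed.

Lemma degree_lin_equiv (D E : tdiv int Z) : lin_equiv D E -> degree D = degree E.
Proof.
move=> /(intersection_lin_equiv (primitive_class_relation n_le finset.set0)).
by rewrite !intersection_primitive_class // !big_set0 !subr0.
Qed.

Lemma slice_spec (W : {set 'I_(2 * m).+1}) (k : nat) :
    (m <= k)%N -> (k + m <= #|W|)%N ->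
  globally_generated (slice W k) /\ ~ lin_equiv (slice W k) (fun=> 0).
Proof.
move=> mk kW; split.
  by apply: Z0_globally_generated mk kW => [i|]; rewrite ?width_slice ?degree_slice.
move/degree_lin_equiv; rewrite degree_slice [RHS]/degree big1 // => /eqP.
by rewrite pnatr_eq0; lia.
Qed.

Lemma Z0_full_cone : has_full_cone Z.
Proof.
have [||S [_ _ Sm]] := @subset_between _ finset.set0 [set: 'I_n]%SET m.
- exact: finset.subsetT.
- by rewrite cards0 cardsT card_ord; lia.
have [||T [_ TS Tm]] := @subset_between _ finset.set0 (~: (idx @: S))%SET m.
- exact: finset.sub0set.
- by rewrite cards0 card_out_image // Sm; lia.
exists (sumset T S); last by rewrite card_sumset Sm Tm /=; lia.
apply: Z0_cone; rewrite ?Sm ?Tm // => i iS; apply/negP => /(fintype.subsetP TS).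
by rewrite inE imset_f.
Qed.

Section TauZ0.
Variables (R : realType) (K : numDomainType) (iota : {rmorphism K -> R}).

Lemma Z0_tau_le (t : R) :
    (forall x : K, m%:R * x <= (2 * m).+1%:R -> iota x <= t) ->
  tau_le iota Z t.
Proof.
move=> mt; apply: (tau_le_relation (primitive_class_relation n_le finset.set0) (d := m)) => //.
  move=> E nE nzE; rewrite intersection_primitive_class // big_set0 subr0.
  exact: nef_degree_ge nE nzE.
move=> x; have -> : \sum_i @primitive_class m n finset.set0 i = (2 * m).+1%:R.
  transitivity (intersection (fun=> 1 : int) (@primitive_class m n finset.set0)).
    by apply: eq_bigr => i _; rewrite mul1r.
  by rewrite intersection_primitive_class // big_set0 subr0 /degree sumr_const card_ord.
by rewrite -pmulrn mulrz_nat; apply: mt.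
Qed.

Lemma Z0_decomposition (r : nat) (a : 'I_r -> K) (E : 'I_r -> tdiv int Z) :
    (forall i, \sum_k a k * (width (E k) i)%:~R = 2) ->
    \sum_k a k * (degree (E k))%:~R = (2 * m).+1%:R ->
  decomposition a E.
Proof.
move=> aw ad; apply: Z0_lin_equiv => [i|].
  rewrite [LHS]/(1%:~R + 1%:~R) [RHS]/width -big_split /= -[LHS]/(2 : K) -(aw i).
  by apply: eq_bigr => k _; rewrite -mulrDr -intrD.
rewrite [LHS]/degree [RHS]/degree sumr_const card_ord -[LHS]/((2 * m).+1%:R) -ad exchange_big.
by apply: eq_bigr => k _; rewrite -mulr_sumr /degree raddf_sum.
Qed.

(** The sum over [i] of the slices omitting the direction [i] has all widths [2m] and
    degree [(2m + 1) m]; multiplied by [c = 1/m], this is the class of [- K]. *)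
Lemma Z0_tau_ge (c : K) :
  0 < c -> m%:R * c = 1 -> tau_ge iota Z (iota c *+ (2 * m).+1).
Proof.
move=> c0 mc; exists (2 * m).+1, (fun=> c), (fun i => slice (~: [set i])%SET m).
have W2m (i : 'I_(2 * m).+1) : #|(~: [set i])%SET| = (2 * m)%N.
  by rewrite cardsCs finset.setCK cards1 card_ord subn1.
split=> //.
- by move=> i; apply: slice_spec; rewrite // W2m; lia.
- apply: Z0_decomposition => [i|].
    under eq_bigr do rewrite width_slice mulrz_nat !inE eq_sym -finset.in_set1 -finset.in_setC.
    by rewrite -mulr_sumr sum_indicator W2m mulrC natrM -mulrA mc mulr1.
  under eq_bigr do rewrite degree_slice mulrz_nat mulrC mc.
  by rewrite sumr_const card_ord.
- by rewrite sumr_const card_ord.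
Qed.

(** The cube of side [2] cut at height [2m + 1] is the Minkowski sum of the unit
    cube cut at heights [m] and [m + 1]. *)
Lemma Z0_tau_ge2 : tau_ge iota Z 2.
Proof.
exists 2%N, (fun=> 1), (fun i => slice [set: _]%SET (m + i)); split=> //.
- move=> i; apply: slice_spec; first exact: leq_addr.
  by rewrite cardsT card_ord; have := ltn_ord i; lia.
- apply: Z0_decomposition => [i|]; rewrite !big_ord_recl big_ord0.
    by rewrite !width_slice !inE !mul1r addr0.
  by rewrite !degree_slice !mul1r addr0 !mulrz_nat -natrD; congr _%:R; rewrite /= /bump /=; lia.
- by rewrite !big_ord_recl big_ord0 rmorph1 addr0.
Qed.

End TauZ0.

Lemma tau_exact_rat_Z0 (R : realType) :
  tau_exact (ratr : rat -> R) Z (2 + m%:R^-1).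
Proof.
have m_neq0 (F : numFieldType) : m%:R != 0 :> F by rewrite pnatr_eq0; lia.
split; first exact: Z0_full_cone.
- apply: (@Z0_tau_le R rat (ratr : {rmorphism rat -> R})) => x.
  rewrite -(ler_rat R) rmorphM !rmorph_nat => mx.
  rewrite -(ler_pM2l (_ : 0 < m%:R)) ?ltr0n // mulrDr mulfV ?m_neq0 //.
  by apply: le_trans mx _; rewrite -natr1 natrM mulrC.
- have tE : ratr (m%:R^-1 : rat) *+ (2 * m).+1 = 2 + m%:R^-1 :> R.
    by rewrite fmorphV rmorph_nat -[LHS]mulr_natr -[(2 * m).+1]addn1 natrD natrM; field; apply: m_neq0.
  have := @Z0_tau_ge R rat (ratr : {rmorphism rat -> R}) m%:R^-1.
  by rewrite tE; apply; [rewrite invr_gt0 ltr0n | apply: mulfV (m_neq0 _)].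
Qed.

(** An integer [x] with [m x <= 2m + 1] is at most [3] if [m = 1], and at most [2] if
    [m >= 2]. *)
Lemma tau_exact_int_Z0 (R : realType) :
  tau_exact (intr : int -> R) Z (if m == 1%N then 3 else 2).
Proof.
split; first exact: Z0_full_cone.
- apply: (@Z0_tau_le R int (intr : {rmorphism int -> R})) => x mx.
  have : x <= (if m == 1%N then 3 else 2).
    by case: ifP mx => [/eqP ->|/eqP m1]; nia.
  by rewrite -(ler_int R); case: (m == 1%N).
- case: eqVneq => [m1|_]; last exact: (@Z0_tau_ge2 R int (intr : {rmorphism int -> R})).
  have := @Z0_tau_ge R int (intr : {rmorphism int -> R}) 1.
  by rewrite [in (2 * m).+1]m1; apply; rewrite // m1.
Qed.

End Z0tau.

Theorem corollary6p2 (R : realType) (X : fan) (s a b p q : nat)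
    (m : 'I_p -> nat) (n : 'I_q -> nat)
    (X_smooth_complete : smooth_complete R X)
    (X_fano : fano X)
    (X_dim : (0 < fdim X)%N)
    (X_pseudo_symmetric : pseudo_symmetric R X)
    (m_ge2 : forall i, (2 <= m i)%N)
    (n_ge2 : forall j, (2 <= n j)%N)
    (X_decomposition :
       fan_iso X (fan_exp P1 s \xF fan_exp (V 1) a \xF fan_exp (Vt 1) b
                  \xF (\xfan_(i < p) V (m i)) \xF (\xfan_(j < q) Vt (n j)))) :
  [/\ tauZ R X = ((2 * s + 3 * (a + b) + 2 * (p + q))%N%:R)%:E,
      tauQ R X = ((2 * s + 3 * (a + b) + 2 * (p + q))%N%:R
                  + \sum_(i < p) (m i)%:R^-1 + \sum_(j < q) (n j)%:R^-1)%:E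
    & delta R X = (\sum_(i < p) (m i)%:R^-1 + \sum_(j < q) (n j)%:R^-1)%:E].
Proof.
have product_tau (K : numDomainType) (iota : {rmorphism K -> R})
    (v vt : nat -> R) :
    {homo iota : x y / x <= y} ->
    (forall k, (0 < k)%N -> tau_exact iota (V k) (v k)) ->
    (forall k, (0 < k)%N -> tau_exact iota (Vt k) (vt k)) ->
  gongyo iota (anticanonical X)
  = (2 *+ s + v 1%N *+ a + vt 1%N *+ b + \sum_i v (m i) + \sum_j vt (n j))%:E.
  move=> iota_le vP vtP; apply: gongyo_iso X_decomposition _.
  have iota_ge0 x : 0 < x -> 0 <= iota x.
    by move=> /ltW/iota_le; rewrite rmorph0.
  have expP (Y : fan) (t : R) (k : nat) : tau_exact iota Y t ->
      tau_exact iota (fan_exp Y k) (t *+ k).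
    move=> Yt; have := @tau_exact_bigprod R K iota 'I_k (fun=> Y) (fun=> t) iota_ge0.
    by rewrite sumr_const card_ord; apply.
  do 4?[apply: tau_exact_prod => //].
  - by apply: expP; apply: tau_exact_P1.
  - by apply: expP; apply: vP.
  - by apply: expP; apply: vtP.
  - by apply: tau_exact_bigprod => // i; apply: vP; apply: ltnW.
  - by apply: tau_exact_bigprod => // j; apply: vtP; apply: ltnW.
have tauZE : tauZ R X = ((2 * s + 3 * (a + b) + 2 * (p + q))%N%:R)%:E.
  pose t k : R := if k == 1%N then 3 else 2.
  rewrite /tauZ (product_tau _ (intr : {rmorphism int -> R}) t t).
  - congr _%:E; have tE k : (2 <= k)%N -> t k = 2 by rewrite /t; case: k => [|[]].
    under eq_bigr do rewrite tE //; under [X in _ + X]eq_bigr do rewrite tE //.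
    by rewrite !sumr_const !card_ord /t /=; ring.
  - by move=> x y; rewrite ler_int.
  - by move=> k k0; apply: tau_exact_int_Z0 => //; lia.
  - by move=> k k0; apply: tau_exact_int_Z0 => //; lia.
have tauQE : tauQ R X = ((2 * s + 3 * (a + b) + 2 * (p + q))%N%:R
                  + \sum_(i < p) (m i)%:R^-1 + \sum_(j < q) (n j)%:R^-1)%:E.
  pose t k : R := 2 + k%:R^-1.
  rewrite /tauQ (product_tau _ (ratr : {rmorphism rat -> R}) t t).
  - congr _%:E; rewrite /t !big_split /= !sumr_const !card_ord invr1; ring.
  - by move=> x y; rewrite ler_rat.
  - by move=> k k0; apply: tau_exact_rat_Z0 => //; lia.
  - by move=> k k0; apply: tau_exact_rat_Z0 => //; lia.
split=> //; rewrite /delta tauZE tauQE -EFinB; congr _%:E.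
ring.
Qed.
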